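(* Let $f:\mathbb{R}^d\to\mathbb{R}$ be convex and twice differentiable, and let $H>0$ be such that for all $x,y\in\mathbb{R}^d$ $$f(y)\le f(x)+\langle\nabla f(x),y-x\rangle+\tfrac12\langle\nabla^2 f(x)(y-x),y-x\rangle+\tfrac H3\|y-x\|^3,\qquad \|\nabla f(y)-\nabla f(x)-\nabla^2 f(x)(y-x)\|\le H\|y-x\|^2 .$$ Let $x^0\in\mathbb{R}^d$, let $x^\star$ be a minimizer of $f$, $f_\star=f(x^\star)$, and assume $D:=\sup\{\|x-x^\star\|:\ f(x)\le f(x^0)\}<\infty$. Let $(x^k)_{k\ge0}$ be generated by the Casual Cubic Newton method (CaCuN) with parameter $H$ started at $x^0$. Then for all $k\ge1$ $$f(x^k)-f_\star\le\frac{3HD^3}{(1+k/3)^2}.$$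
   Context: $\|\cdot\|$ is the Euclidean norm. The method CaCuN: for $k=0,1,2,\dots$, given $x^k$ with $\nabla f(x^k)\neq0$ (if $\nabla f(x^k)=0$ set $x^{k+1}=x^k$): (a) if $$f\Big(x^k-\frac{2\nabla f(x^k)}{\sqrt{3H\|\nabla f(x^k)\|}}\Big)\le f(x^k)-\frac{1}{\sqrt{2H}}\Big(\frac23\Big)^{3/2}\|\nabla f(x^k)\|^{3/2},$$ set $x^{k+1}=x^k-\frac{2\nabla f(x^k)}{\sqrt{3H\|\nabla f(x^k)\|}}$ (gradient step); (b) otherwise, let $x^{k+1}$ be the cubic regularized Newton step, i.e. the solution of $x^{k+1}=x^k-(\nabla^2 f(x^k)+H\|x^{k+1}-x^k\|I)^{-1}\nabla f(x^k)$; equivalently, $x^{k+1}$ is the minimizer over $y$ of $f(x^k)+\langle\nabla f(x^k),y-x^k\rangle+\frac12\langle\nabla^2 f(x^k)(y-x^k),y-x^k\rangle+\frac H3\|y-x^k\|^3$. *)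

(* Defs.v *)
From HB Require Import structures.
From mathcomp Require Import all_boot all_order all_algebra.
From mathcomp Require Import all_classical all_reals all_analysis.

Set Implicit Arguments.
Unset Strict Implicit.
Unset Printing Implicit Defensive.

Import Order.TTheory GRing.Theory Num.Theory.
Import numFieldNormedType.Exports.

Local Open Scope classical_set_scope.
Local Open Scope ring_scope.

(* Vectors of R^d are row vectors, so a matrix A acts on v as [v *m A]. *)

Definition dotv (R : realType) (d : nat) (u v : 'rV[R]_d) : R :=
  \sum_(i < d) u ord0 i * v ord0 i.

(* The library norm [`|v|] on 'rV[R]_d is the sup norm; it induces the same
   topology, hence the same notion of differentiability, as [enorm]. *)
Definition enorm (R : realType) (d : nat) (v : 'rV[R]_d) : R :=
  Num.sqrt (dotv v v).

Definition grad (R : realType) (d : nat) (f : 'rV[R]_d -> R) (x : 'rV[R]_d) :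
    'rV[R]_d :=
  \row_(i < d) 'D_(delta_mx ord0 i) f x.

(* [v *m hess f x] is the derivative of [grad f] at x along v. *)
Definition hess (R : realType) (d : nat) (f : 'rV[R]_d -> R) (x : 'rV[R]_d) :
    'M[R]_d :=
  jacobian (grad f) x.

Definition twice_differentiable (R : realType) (d : nat)
    (f : 'rV[R]_d -> R) : Prop :=
  (forall x, differentiable f x) /\ (forall x, differentiable (grad f) x).

Definition gradient_step (R : realType) (d : nat) (f : 'rV[R]_d -> R) (H : R)
    (x : 'rV[R]_d) : 'rV[R]_d :=
  x - (2 / Num.sqrt (3 * H * enorm (grad f x))) *: grad f x.

Definition gradient_step_accepted (R : realType) (d : nat)
    (f : 'rV[R]_d -> R) (H : R) (x : 'rV[R]_d) : bool :=
  f (gradient_step f H x) <=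
    f x - (Num.sqrt (2 * H))^-1 * ((2 / 3) `^ (3 / 2))
          * (enorm (grad f x) `^ (3 / 2)).

(* Invertibility is required explicitly because [invmx A = A] when A is
   singular, which would admit spurious solutions such as [y = x]. *)
Definition cubic_newton_step (R : realType) (d : nat) (f : 'rV[R]_d -> R)
    (H : R) (x y : 'rV[R]_d) : Prop :=
  let A := hess f x + (H * enorm (y - x))%:M in
  A \in unitmx /\ y = x - grad f x *m invmx A.

Definition cacun_step (R : realType) (d : nat) (f : 'rV[R]_d -> R) (H : R)
    (x y : 'rV[R]_d) : Prop :=
  if grad f x == 0 then y = x
  else if gradient_step_accepted f H x then y = gradient_step f H x
  else cubic_newton_step f H x y.

Definition cacun (R : realType) (d : nat) (f : 'rV[R]_d -> R) (H : R)
    (x0 : 'rV[R]_d) (x : nat -> 'rV[R]_d) : Prop :=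
  x 0%N = x0 /\ forall k, cacun_step f H (x k) (x k.+1).

Definition sublevel_dists (R : realType) (d : nat) (f : 'rV[R]_d -> R)
    (x0 xstar : 'rV[R]_d) : set R :=
  [set enorm (x - xstar) | x in [set x | f x <= f x0]].

(* Main.v *)
Require Import Defs.
From HB Require Import structures.
From mathcomp Require Import all_boot all_order all_algebra.
From mathcomp Require Import all_classical all_reals all_analysis.
From mathcomp Require Import ring lra.

Set Implicit Arguments.
Unset Strict Implicit.
Unset Printing Implicit Defensive.

Import Order.TTheory GRing.Theory Num.Theory.
Import numFieldNormedType.Exports.

Local Open Scope classical_set_scope.
Local Open Scope ring_scope.

(** If [D = 0], every iterate is [xstar]. Otherwise normalise the gap to
[u k = (f (x k) - f xstar) / (H * D ^+ 3)]; the claim is then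
[u k <= 27 / (k + 3) ^+ 2]. It follows from a recursion in which each
step [u -> v] satisfies one of two scalar inequalities ([cacun_step_decrease]).

An accepted gradient step gives [4 u ^ 3 <= 27 (u - v) ^ 2]: the acceptance
test bounds the drop below by a multiple of [|grad f x| ^ (3/2)], and convexity
bounds the gap at [x] by [|grad f x| D].

For a Newton step put [s = y - x], [r = |s|] and [G = grad f y]. The step
equation turns the gradient bound into [|G + H r s| <= H r ^ 2]. Squaring it
gives [|G| ^ 2 <= 2 H r (- <G, s>)], and convexity at [y] gives
[- <G, s> <= f x - f y]; the cubic upper model gives
[2/3 H r ^ 3 <= f x - f y]. Eliminating [r] between the two yields
[|G| ^ 3 <= 4 H (f x - f y) ^ 2], hence [v ^ 3 <= 4 (u - v) ^ 2] because the gap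
at [y] is at most [|G| D]. The same residual bound, combined with [f y - f xstar <= <G, y - xstar>], also gives
[v <= 16/27] however large [u] is ([newton_gap_le]).

Both inequalities force [v <= 1], which starts the recursion at [k = 1], and
both carry the bound [27 / m ^ 2] to [27 / (m + 1) ^ 2] for [m >= 4]
([decrease_rate]). The cubic inequality of the Newton step alone would do the
latter only for [v] not too large; [v <= 16/27] is small enough. *)

(** * Euclidean inner product and norm *)

Section InnerProduct.
Context {R : realType} {d : nat}.
Implicit Types u v w : 'rV[R]_d.

Lemma dotvC u v : dotv u v = dotv v u.
Proof. by apply: eq_bigr => i _; rewrite mulrC. Qed.

Lemma dotvDl u v w : dotv (u + v) w = dotv u w + dotv v w.
Proof. by rewrite -big_split; apply: eq_bigr => i _; rewrite mxE mulrDl. Qed.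

Lemma dotvZl a u v : dotv (a *: u) v = a * dotv u v.
Proof. by rewrite /dotv mulr_sumr; apply: eq_bigr => i _; rewrite mxE mulrA. Qed.

Lemma dotvNl u v : dotv (- u) v = - dotv u v.
Proof. by rewrite -scaleN1r dotvZl mulN1r. Qed.

Lemma dotvDr u v w : dotv u (v + w) = dotv u v + dotv u w.
Proof. by rewrite !(dotvC u) dotvDl. Qed.

Lemma dotvZr a u v : dotv u (a *: v) = a * dotv u v.
Proof. by rewrite !(dotvC u) dotvZl. Qed.

Lemma dotvNr u v : dotv u (- v) = - dotv u v.
Proof. by rewrite !(dotvC u) dotvNl. Qed.

Definition dotvE := (dotvDl, dotvDr, dotvNl, dotvNr, dotvZl, dotvZr).

Lemma dotvv_ge0 u : 0 <= dotv u u.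
Proof. by apply: sumr_ge0 => i _; rewrite -expr2 sqr_ge0. Qed.

Lemma enorm_ge0 u : 0 <= enorm u.
Proof. exact: sqrtr_ge0. Qed.

Lemma sqr_enorm u : enorm u ^+ 2 = dotv u u.
Proof. exact/sqr_sqrtr/dotvv_ge0. Qed.

Lemma sqr_enormD u v :
  enorm (u + v) ^+ 2 = enorm u ^+ 2 + 2 * dotv u v + enorm v ^+ 2.
Proof. by rewrite !sqr_enorm !dotvE (dotvC v u); ring. Qed.

Lemma sqr_enormB u v :
  enorm (u - v) ^+ 2 = enorm u ^+ 2 - 2 * dotv u v + enorm v ^+ 2.
Proof. by rewrite !sqr_enorm !dotvE (dotvC v u); ring. Qed.

Lemma enormZ a u : 0 <= a -> enorm (a *: u) = a * enorm u.
Proof.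
move=> a0; rewrite /enorm !dotvE mulrA -expr2 sqrtrM ?sqr_ge0//.
by rewrite sqrtr_sqr ger0_norm.
Qed.

Lemma enorm0_eq0 u : enorm u = 0 -> u = 0.
Proof.
move=> u0; have /eqP : dotv u u = 0 by rewrite -sqr_enorm u0 expr0n.
rewrite psumr_eq0 => [/allP u_eq0|i _]; last by rewrite -expr2 sqr_ge0.
apply/rowP => i; rewrite mxE.
by have := u_eq0 i (mem_index_enum _); rewrite -expr2 sqrf_eq0 => /eqP.
Qed.

Lemma dotv_le_enorm u v : dotv u v <= enorm u * enorm v.
Proof.
have [u0|u_neq0] := eqVneq (enorm u) 0.
  by rewrite (enorm0_eq0 u0) -(scale0r 0) dotvZl mul0r mulr_ge0 ?enorm_ge0.
have [v0|v_neq0] := eqVneq (enorm v) 0.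
  by rewrite (enorm0_eq0 v0) -(scale0r 0) dotvZr mul0r mulr_ge0 ?enorm_ge0.
have uv_gt0 : 0 < enorm u * enorm v.
  by rewrite mulr_gt0// lt_neqAle eq_sym ?u_neq0 ?v_neq0 enorm_ge0.
have := dotvv_ge0 (enorm v *: u - enorm u *: v).
rewrite !dotvE (dotvC v u) -!sqr_enorm => sq_ge0.
by rewrite -subr_ge0 -(pmulr_rge0 _ uv_gt0); lra.
Qed.

End InnerProduct.

(** * First-order consequences of convexity *)

Section Convexity.
Context {R : realType} {d : nat}.
Implicit Types (f : 'rV[R]_d -> R) (x y : 'rV[R]_d).

Lemma diff_dotv f x v : differentiable f x -> 'd f x v = dotv (grad f x) v.
Proof.
move=> fx; rewrite [in LHS](row_sum_delta v) linear_sum.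
by apply: eq_bigr => i _; rewrite linearZ mxE deriveE//= mulrC.
Qed.

(** The difference quotient of [f] at [x] along [y - x] is at most [f y - f x]
for increments in (0, 1], so its limit is too. *)
Lemma convex_grad_le f x y : convex_function [set: 'rV[R]_d] f ->
  differentiable f x -> f x + dotv (grad f x) (y - x) <= f y.
Proof.
move=> fconv fx; rewrite -diff_dotv// -deriveE// -lerBrDl.
have dfx : derivable f x (y - x) by exact: diff_derivable.
apply: (cvgr_to_le (cvg_dnbhs_at_right dfx)).
near=> t.
have t0 : 0 < t by near: t; exact: nbhs_right_gt.
have t1 : t <= 1 by near: t; apply: nbhs_right_le.
have := fconv (Itv01 (ltW t0) t1) y x (in_setT _) (in_setT _).
have -> : conv (Itv01 (ltW t0) t1) (y : convex_lmodType _) x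
    = t *: (y - x) + x.
  rewrite [LHS](_ : _ = t *: y + (1 - t) *: x)//.
  by rewrite scalerBl scale1r scalerBr addrA addrAC.
rewrite convRE /= => conv_le.
have {}conv_le : f (t *: (y - x) + x) <= t * f y + (1 - t) * f x by [].
rewrite -[_ *: _]/(t^-1 * _) ler_pdivrMl//=.
lra.
Unshelve. all: by end_near. Qed.

(** With [A = hess f x], the convexity lower bound and the cubic upper model at
[x + t s] leave [0 <= t^2/2 <s A, s> + O(t^3)]; divide by [t^2] and let [t]
tend to 0. *)
Lemma hess_form_ge0 f (H : R) x s : convex_function [set: 'rV[R]_d] f ->
  differentiable f x -> 0 < H ->
  (forall v, f v <= f x + dotv (grad f x) (v - x)
                    + 2^-1 * dotv ((v - x) *m hess f x) (v - x)
                    + H / 3 * enorm (v - x) ^+ 3) ->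
  0 <= dotv (s *m hess f x) s.
Proof.
move=> fconv fx H0 f_upper.
suff approx (e : R) : 0 < e -> 0 <= dotv (s *m hess f x) s + e.
  by apply/ler_addgt0Pr => e; exact: approx.
move=> e0.
pose c := 2 / 3 * H * enorm s ^+ 3.
have c0 : 0 <= c by rewrite !mulr_ge0 ?exprn_ge0 ?enorm_ge0 ?ltW.
pose t : R := e / (c + 1).
have t0 : 0 < t by rewrite divr_gt0//; lra.
have ct : c * t <= e.
  by rewrite /t mulrCA ler_piMr ?(ltW e0)// ler_pdivrMr; lra.
have := le_trans (convex_grad_le (t *: s + x) fconv fx) (f_upper _).
rewrite !addrK enormZ ?(ltW t0)// -scalemxAl !dotvE => upper.
suff : 0 <= t ^+ 2 * (dotv (s *m hess f x) s + c * t).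
  by rewrite pmulr_rge0 ?exprn_gt0// => ?; lra.
rewrite /c; lra.
Qed.

End Convexity.

(** * Scalar recursions *)

Section Rate.
Context {R : realType}.
Implicit Types u v m : R.

Lemma sqrt_third u : 0 <= u -> exists2 q, 0 <= q & u = 3 * q ^+ 2.
Proof.
move=> u0; exists (Num.sqrt (u / 3)); first exact: sqrtr_ge0.
by rewrite sqr_sqrtr; [field|rewrite divr_ge0].
Qed.

(** [u] and [v] are the normalised gaps before and after a step. The exponents
3/2 of the method are squared away, so that only polynomials occur. *)
Definition gradient_decrease u v := v <= u /\ 4 * u ^+ 3 <= 27 * (u - v) ^+ 2.

Definition newton_decrease u v :=
  [/\ v <= u, v ^+ 3 <= 4 * (u - v) ^+ 2 & v <= 16 / 27].

(** Substituting [u = 3 q ^ 2] makes the power 3/2 of [u] a cube of [q]. *)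
Lemma gradient_decreaseP q v : 0 <= q -> gradient_decrease (3 * q ^+ 2) v ->
  v <= 3 * q ^+ 2 - 2 * q ^+ 3.
Proof.
move=> q0 [vu drop].
suff : 2 * q ^+ 3 <= 3 * q ^+ 2 - v by lra.
by rewrite -ler_sqr ?nnegrE; [|rewrite mulr_ge0 ?exprn_ge0|]; lra.
Qed.

(** For [q >= 0], [3 q ^ 2 - 2 q ^ 3] has maximum 1, reached at [q = 1]: one
gradient step brings the normalised gap to at most 1 from any starting point. *)
Lemma gradient_decrease_le1 u v : 0 <= u -> gradient_decrease u v -> v <= 1.
Proof.
move=> /sqrt_third[q q0 ->] /(gradient_decreaseP q0) vq.
have : 0 <= (1 - q) ^+ 2 * (1 + 2 * q) by rewrite mulr_ge0 ?sqr_ge0//; lra.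
lra.
Qed.

Lemma gradient_decrease_rate u v m : 4 <= m -> 0 <= u ->
  gradient_decrease u v -> u <= 27 / m ^+ 2 -> v <= 27 / (m + 1) ^+ 2.
Proof.
move=> m4 /sqrt_third[q q0 ->] /(gradient_decreaseP q0) vq um.
have m0 : 0 < m by lra.
pose a := 3 / m.
have a0 : 0 <= a by rewrite divr_ge0 ?ltW.
have a1 : a <= 3 / 4 by rewrite ler_pdivrMr//; lra.
have qa : q <= a.
  rewrite -ler_sqr ?nnegrE// /a expr_div_n.
  by rewrite (_ : 3 ^+ 2 / _ = (27 / m ^+ 2) / 3); [lra|field; lra].
(* q |-> 3 q^2 - 2 q^3 is nondecreasing on [0, 1] *)
have mono : 3 * q ^+ 2 - 2 * q ^+ 3 <= 3 * a ^+ 2 - 2 * a ^+ 3.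
  have : 0 <= (a - q) * (a * (3 - 2 * a - q) + q * (3 - 2 * q - a)).
    by rewrite mulr_ge0 ?subr_ge0// addr_ge0// mulr_ge0//; lra.
  lra.
apply: le_trans vq (le_trans mono _).
rewrite /a (_ : _ - _ = 27 * (m - 2) / m ^+ 3); last by field; lra.
rewrite ler_pdivrMr ?exprn_gt0// mulrAC ler_pdivlMr ?exprn_gt0//; last lra.
by rewrite -!mulrA ler_pM2l//; nra.
Qed.

(** With [u = 3 q ^ 2] and [v = 3 p ^ 2] the decrease reads
[q ^ 2 >= p ^ 2 + (sqrt 3 / 2) p ^ 3], and the claim is [p (m + 1) <= 3] given
[q m <= 3]. If it failed, [m p > 3 - p] would give
[(3 - p) ^ 2 (1 + 0.86 p) <= 9], which is false for [0 < p <= 4/9]; the bound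
[p <= 4/9] is [v <= 16/27]. *)
Lemma newton_decrease_rate u v m : 4 <= m -> 0 <= u -> 0 <= v ->
  newton_decrease u v -> u <= 27 / m ^+ 2 -> v <= 27 / (m + 1) ^+ 2.
Proof.
move=> m4 /sqrt_third[q q0 ->] /sqrt_third[p p0 ->] [vu drop v_small] um.
have m0 : 0 < m by lra.
have p_small : p <= 4 / 9 by rewrite -ler_sqr ?nnegrE//; lra.
(* 3 * 0.86 = 2.58 is a rational lower bound of sqrt (27 / 4) *)
have drop_ge : 258 / 100 * p ^+ 3 <= 3 * q ^+ 2 - 3 * p ^+ 2.
  have p6 : 0 <= (p ^+ 3) ^+ 2 by exact: sqr_ge0.
  by rewrite -ler_sqr ?nnegrE; [|rewrite mulr_ge0 ?exprn_ge0|]; lra.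
have qm : (m * q) ^+ 2 <= 9.
  by move: um; rewrite ler_pdivlMr ?exprn_gt0// exprMn; lra.
suff pm : p * (m + 1) <= 3.
  rewrite ler_pdivlMr ?exprn_gt0//; last lra.
  have : (p * (m + 1)) ^+ 2 <= 3 ^+ 2.
    by rewrite ler_sqr ?nnegrE// mulr_ge0//; lra.
  by rewrite exprMn; lra.
rewrite leNgt; apply/negP => pm.
have p_gt0 : 0 < p.
  rewrite lt_neqAle p0 andbT; apply/eqP => p_eq0.
  by move: pm; rewrite -p_eq0; lra.
have low : (3 - p) ^+ 2 <= (m * p) ^+ 2.
  by rewrite ler_sqr ?nnegrE ?mulr_ge0//; lra.
have up : (m * p) ^+ 2 * (1 + 86 / 100 * p) <= 9.
  apply: le_trans qm.
  rewrite (_ : _ * _ = m ^+ 2 * (p ^+ 2 + 86 / 100 * p ^+ 3)); last by ring.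
  by rewrite exprMn ler_pM2l ?exprn_gt0//; lra.
have : (3 - p) ^+ 2 * (1 + 86 / 100 * p) <= 9.
  by apply: le_trans up; rewrite ler_pM2r//; lra.
suff : 0 < p * (174 / 100 - 416 / 100 * p + 86 / 100 * p ^+ 2) by lra.
rewrite mulr_gt0//.
(* the tangent of p ^ 2 at 4 / 9 reduces this to a linear inequality *)
have := sqr_ge0 (p - 4 / 9); lra.
Qed.

Lemma decrease_rate (u : nat -> R) : (forall k, 0 <= u k) ->
  (forall k, gradient_decrease (u k) (u k.+1) \/
             newton_decrease (u k) (u k.+1)) ->
  forall k, (1 <= k)%N -> u k <= 27 / (k%:R + 3) ^+ 2.
Proof.
move=> u0 decr [//|k] _; elim: k => [|k IHk].
  have u1 : u 1%N <= 1.
    by case: (decr 0%N) => [/(gradient_decrease_le1 (u0 _))//|[_ _]]; lra.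
  by apply: (le_trans u1); rewrite ler_pdivlMr ?exprn_gt0//; lra.
have m4 : 4 <= k.+1%:R + 3 :> R by rewrite -natr1; have := ler0n R k; lra.
rewrite (_ : k.+2%:R + 3 = k.+1%:R + 3 + 1); last by rewrite -natr1 addrAC.
case: (decr k.+1) => step.
  exact: gradient_decrease_rate m4 (u0 _) step IHk.
exact: newton_decrease_rate m4 (u0 _) (u0 _) step IHk.
Qed.

End Rate.

(** * The two steps of the method *)

Section Steps.
Context {R : realType} {d : nat} (f : 'rV[R]_d -> R) (H : R) (xstar : 'rV[R]_d).
Hypothesis f_convex : convex_function [set: 'rV[R]_d] f.
Hypothesis f_diff : forall x, differentiable f x.
Hypothesis H_gt0 : 0 < H.
Implicit Types x y : 'rV[R]_d.

Lemma gap_le_grad x : f x - f xstar <= dotv (grad f x) (x - xstar).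
Proof.
have := convex_grad_le xstar f_convex (f_diff x).
by rewrite -opprB dotvNr; lra.
Qed.

Lemma gap_le_enorm x D : enorm (x - xstar) <= D ->
  f x - f xstar <= enorm (grad f x) * D.
Proof.
move=> xD; apply: le_trans (gap_le_grad x) (le_trans (dotv_le_enorm _ _) _).
by rewrite ler_wpM2l ?enorm_ge0.
Qed.

(** For [g = |grad f x|] the drop required by the acceptance test is
[sqrt (4 g ^ 3 / (27 H))]. *)
Lemma gradient_step_decrease x : gradient_step_accepted f H x ->
  f (gradient_step f H x) <= f x /\
  4 * enorm (grad f x) ^+ 3 <= 27 * H * (f x - f (gradient_step f H x)) ^+ 2.
Proof.
rewrite /gradient_step_accepted => accepted.
set g := enorm (grad f x) in accepted *.
set drop := _ * _ in accepted.
have drop0 : 0 <= drop by rewrite !mulr_ge0 ?invr_ge0 ?sqrtr_ge0 ?powR_ge0.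
have powR32 (a : R) : 0 <= a -> (a `^ (3 / 2)) ^+ 2 = a ^+ 3.
  by move=> a0; rewrite -powR_mulrn ?powR_ge0// -powRrM divfK// powR_mulrn.
have drop2 : drop ^+ 2 * (27 * H) = 4 * g ^+ 3.
  rewrite /drop !exprMn exprVn sqr_sqrtr ?mulr_ge0 ?ltW//.
  rewrite !powR32 ?enorm_ge0// ?divr_ge0//.
  by field; rewrite gt_eqF.
split; first lra.
rewrite -drop2 [leRHS]mulrC ler_pM2r ?mulr_gt0//.
by rewrite ler_sqr ?nnegrE//; lra.
Qed.

Section NewtonStep.
Variables x y : 'rV[R]_d.
Hypothesis f_upper : forall v,
  f v <= f x + dotv (grad f x) (v - x)
         + 2^-1 * dotv ((v - x) *m hess f x) (v - x)
         + H / 3 * enorm (v - x) ^+ 3.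
Hypothesis grad_bound :
  enorm (grad f y - grad f x - (y - x) *m hess f x)
    <= H * enorm (y - x) ^+ 2.
Hypothesis step : cubic_newton_step f H x y.

Let s := y - x.
Let r := enorm s.
Let G := grad f y.

(** The implicit step equation, freed of the inverse matrix. *)
Lemma newton_equation : s *m hess f x = - grad f x - (H * r) *: s.
Proof.
case: step => A_unit y_def.
have : s *m (hess f x + (H * r)%:M) = - grad f x.
  rewrite /s {1}y_def addrAC subrr add0r mulNmx; congr (- _).
  exact: mulmxKV.
by rewrite mulmxDr mul_mx_scalar => <-; rewrite addrK.
Qed.

Lemma newton_residual : enorm (G + (H * r) *: s) <= H * r ^+ 2.
Proof.
move: grad_bound; rewrite -/s newton_equation -/G -/r.
by rewrite opprD !opprK addrA subrK.
Qed.

Lemma newton_drop_ge : 2 / 3 * H * r ^+ 3 <= f x - f y.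
Proof.
have Q0 : 0 <= dotv (s *m hess f x) s by exact: hess_form_ge0 H_gt0 f_upper.
have Q_eq : dotv (s *m hess f x) s = - dotv (grad f x) s - H * r ^+ 3.
  by rewrite newton_equation dotvDl !dotvNl dotvZl -sqr_enorm -/r; ring.
have := f_upper y; rewrite -/s -/r; lra.
Qed.

Lemma newton_le : f y <= f x.
Proof.
have : 0 <= 2 / 3 * H * r ^+ 3.
  by rewrite !mulr_ge0 ?exprn_ge0 ?enorm_ge0// ltW.
by have := newton_drop_ge; lra.
Qed.

(** Squaring the residual bound cancels the [H^2 r^4] terms and leaves
[|G|^2 + 2 H r <G, s> <= 0]; convexity at [y] bounds [- <G, s>] by the drop. *)
Lemma newton_grad_le : enorm G ^+ 2 <= 2 * H * r * (f x - f y).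
Proof.
have Hr0 : 0 <= H * r by rewrite mulr_ge0 ?enorm_ge0// ltW.
have Gs : - dotv G s <= f x - f y.
  have := convex_grad_le x f_convex (f_diff y).
  by rewrite -opprB -/s dotvNr -/G; lra.
have : enorm (G + (H * r) *: s) ^+ 2 <= (H * r ^+ 2) ^+ 2.
  rewrite ler_sqr ?nnegrE ?enorm_ge0//; first exact: newton_residual.
  by rewrite mulr_ge0 ?sqr_ge0// ltW.
rewrite sqr_enormD enormZ// dotvZr -/r => residual.
have := ler_wpM2l Hr0 Gs; lra.
Qed.

(** Write [drop] for [f x - f y]. A large [r] makes [2/3 H r^3 <= drop] strong,
a small [r] makes [|G|^2 <= 2 H r drop] strong; cubing the latter and inserting
the former eliminates [r]: [|G|^6 <= 12 H^2 drop^4]. Rounding 12 up to 16 makes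
the right side a square. *)
Lemma newton_grad_cube_le : enorm G ^+ 3 <= 4 * H * (f x - f y) ^+ 2.
Proof.
have := newton_grad_le; have := newton_drop_ge; have := newton_le.
set drop := f x - f y => fyx drop_ge G2.
have drop0 : 0 <= drop by rewrite subr_ge0.
have H0 := ltW H_gt0.
rewrite -ler_sqr ?nnegrE ?exprn_ge0 ?enorm_ge0//; last first.
  by rewrite !mulr_ge0// sqr_ge0.
have G6 : (enorm G ^+ 3) ^+ 2 <= (2 * H * r * drop) ^+ 3.
  by rewrite exprAC lerXn2r ?nnegrE ?sqr_ge0// (le_trans _ G2)// sqr_ge0.
apply: (le_trans G6).
have : 0 <= 12 * H ^+ 2 * drop ^+ 3 * (drop - 2 / 3 * H * r ^+ 3).
  by rewrite !mulr_ge0 ?exprn_ge0// subr_ge0.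
have : 0 <= H ^+ 2 * drop ^+ 4 by rewrite mulr_ge0 ?exprn_ge0.
lra.
Qed.

(** Let [a] and [b] be the distances of [x] and [y] to [xstar]. Splitting
[G = (G + H r s) - H r s] in [<G, y - xstar>] and using the law of cosines gives
[f y - f xstar <= H r (a^2 - (r - b)^2) / 2]. With [a, b <= D] this is at most
[H D^3 / 2] for [r <= D], and at most [H r^2 (2 D - r) / 2] for [r > D], whose
maximum [16/27 H D^3] is reached at [r = 4 D / 3]. *)
Lemma newton_gap_le D : enorm (x - xstar) <= D -> enorm (y - xstar) <= D ->
  f y - f xstar <= 16 / 27 * (H * D ^+ 3).
Proof.
set a := enorm (x - _); set b := enorm (y - _) => aD bD.
have [a0 b0 r0] : [/\ 0 <= a, 0 <= b & 0 <= r] by rewrite !enorm_ge0.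
have gap : f y - f xstar
    <= H * r ^+ 2 * b - H * r * dotv s (y - xstar).
  apply: le_trans (gap_le_grad y) _; rewrite -/G.
  have -> : dotv G (y - xstar) =
      dotv (G + (H * r) *: s) (y - xstar) - H * r * dotv s (y - xstar).
    by rewrite dotvDl dotvZl addrK.
  rewrite lerD2r (le_trans (dotv_le_enorm _ _))//.
  by rewrite ler_wpM2r ?newton_residual.
(* law of cosines in the triangle x, y, xstar *)
have cosine : 2 * dotv s (y - xstar) = r ^+ 2 + b ^+ 2 - a ^+ 2.
  have -> : a = enorm ((y - xstar) - s).
    by congr enorm; rewrite /s opprB [RHS]addrC addrA subrK.
  by rewrite sqr_enormB (dotvC _ s) -/r -/b; ring.
have gap2 : f y - f xstar <= H * (r * (a ^+ 2 - (r - b) ^+ 2) / 2).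
  apply: (le_trans gap).
  by rewrite (_ : dotv s _ = (r ^+ 2 + b ^+ 2 - a ^+ 2) / 2); lra.
apply: (le_trans gap2).
rewrite [leRHS]mulrCA ler_pM2l//.
have D0 : 0 <= D by lra.
have a2D : a ^+ 2 <= D ^+ 2 by rewrite ler_sqr ?nnegrE.
have [rD|Dr] := leP r D.
  have : r * (a ^+ 2 - (r - b) ^+ 2) <= D * D ^+ 2.
    apply: (@le_trans _ _ (r * D ^+ 2)).
      by rewrite ler_wpM2l//; have := sqr_ge0 (r - b); lra.
    by rewrite ler_wpM2r ?sqr_ge0.
  have : 0 <= D ^+ 3 by rewrite exprn_ge0.
  lra.
have rb : (r - D) ^+ 2 <= (r - b) ^+ 2 by rewrite ler_sqr ?nnegrE//; lra.
have : r * (a ^+ 2 - (r - b) ^+ 2) <= r * (D ^+ 2 - (r - D) ^+ 2).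
  by rewrite ler_wpM2l//; lra.
have : 0 <= (r - 4 / 3 * D) ^+ 2 * (r + 2 / 3 * D).
  by rewrite mulr_ge0 ?sqr_ge0//; lra.
lra.
Qed.

End NewtonStep.
End Steps.

Lemma cacun_step_le (R : realType) (d : nat) (f : 'rV[R]_d -> R) (H : R)
    (x y : 'rV[R]_d) :
  convex_function [set: 'rV[R]_d] f -> (forall u, differentiable f u) -> 0 < H ->
  (forall v : 'rV[R]_d,
     f v <= f x + dotv (grad f x) (v - x)
            + 2^-1 * dotv ((v - x) *m hess f x) (v - x)
            + H / 3 * enorm (v - x) ^+ 3) ->
  cacun_step f H x y -> f y <= f x.
Proof.
move=> f_convex f_diff H_gt0 f_upper; rewrite /cacun_step.
case: ifP => [_ -> //|_]; case: ifP => [accepted ->|_].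
  by have [] := gradient_step_decrease H_gt0 accepted.
by move=> newton; exact: (newton_le f_convex f_diff H_gt0 f_upper newton).
Qed.

Lemma cacun_step_decrease (R : realType) (d : nat) (f : 'rV[R]_d -> R) (H D : R)
    (xstar x y : 'rV[R]_d) :
  convex_function [set: 'rV[R]_d] f -> (forall u, differentiable f u) ->
  0 < H ->
  (forall v : 'rV[R]_d,
     f v <= f x + dotv (grad f x) (v - x)
            + 2^-1 * dotv ((v - x) *m hess f x) (v - x)
            + H / 3 * enorm (v - x) ^+ 3) ->
  (enorm (grad f y - grad f x - (y - x) *m hess f x)
     <= H * enorm (y - x) ^+ 2) ->
  (forall v, f xstar <= f v) ->
  (forall v, f v <= f x -> enorm (v - xstar) <= D) -> 0 < D ->
  cacun_step f H x y ->
  gradient_decrease ((f x - f xstar) / (H * D ^+ 3))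
                    ((f y - f xstar) / (H * D ^+ 3)) \/
  newton_decrease ((f x - f xstar) / (H * D ^+ 3))
                  ((f y - f xstar) / (H * D ^+ 3)).
Proof.
move=> f_convex f_diff H_gt0 f_upper grad_bound xstar_min f_dist D_gt0.
have D0 := ltW D_gt0.
set K := H * D ^+ 3.
have K0 : 0 < K by rewrite mulr_gt0 ?exprn_gt0.
have gap0 v : 0 <= f v - f xstar by rewrite subr_ge0.
have cube v : enorm (v - xstar) <= D ->
    (f v - f xstar) ^+ 3 <= enorm (grad f v) ^+ 3 * D ^+ 3.
  move=> vD; rewrite -exprMn lerXn2r ?nnegrE ?mulr_ge0 ?enorm_ge0//.
  exact: gap_le_enorm.
have le_scaled v : f v <= f x ->
    (f v - f xstar) / K <= (f x - f xstar) / K.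
  by move=> vx; rewrite ler_pM2r ?invr_gt0// lerD2r.
have scaled (c1 c2 : R) v w :
    c1 * (f w - f xstar) ^+ 3 <= c2 * K * (f x - f v) ^+ 2 ->
    c1 * ((f w - f xstar) / K) ^+ 3 <=
      c2 * ((f x - f xstar) / K - (f v - f xstar) / K) ^+ 2.
  move=> le; rewrite -mulrBl opprB addrA subrK expr_div_n.
  have -> : c2 * ((f x - f v) / K) ^+ 2
      = c2 * K * (f x - f v) ^+ 2 / K ^+ 3 by field; rewrite gt_eqF.
  by rewrite mulrA ler_pM2r// invr_gt0 exprn_gt0.
rewrite /cacun_step; case: ifPn => [/eqP gradx0 ->|_].
  left; split=> //.
  have /eqP -> : f x - f xstar == 0.
    rewrite eq_le gap0 andbT (le_trans (gap_le_grad xstar f_convex f_diff x))//.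
    by rewrite gradx0 -(scale0r 0) dotvZl mul0r.
  by rewrite mul0r expr0n/= mulr0 mulr_ge0// sqr_ge0.
case: ifPn => [accepted ->|_ newton].
  have [yx drop] := gradient_step_decrease H_gt0 accepted.
  left; split; first exact: le_scaled.
  apply: scaled.
  have {}drop := ler_wpM2r (exprn_ge0 3 D0) drop.
  have := ler_wpM2l (ler0n R 4) (cube x (f_dist _ (lexx _))).
  rewrite /K; lra.
have yx : f y <= f x by exact: (newton_le f_convex f_diff H_gt0 f_upper newton).
right; split; first exact: le_scaled.
  rewrite -[leLHS]mul1r; apply: scaled; rewrite mul1r.
  apply: le_trans (cube _ (f_dist _ yx)) _.
  rewrite mulrC /K [leRHS](_ : _ = D ^+ 3 * (4 * H * (f x - f y) ^+ 2));
    last by ring.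
  rewrite ler_wpM2l ?exprn_ge0//.
  exact: (newton_grad_cube_le f_convex f_diff H_gt0 f_upper grad_bound newton).
rewrite ler_pdivrMr//.
apply: (newton_gap_le f_convex f_diff H_gt0 grad_bound newton) => //.
  exact: f_dist.
exact: f_dist.
Qed.

Theorem mainTheorem2 (R : realType) (d : nat) (f : 'rV[R]_d -> R) (H : R)
    (x0 xstar : 'rV[R]_d) (x : nat -> 'rV[R]_d)
    (f_convex : convex_function [set: 'rV[R]_d] f)
    (f_diff2 : twice_differentiable f)
    (H_gt0 : 0 < H)
    (f_upper : forall u v : 'rV[R]_d,
       f v <= f u + dotv (grad f u) (v - u)
              + 2^-1 * dotv ((v - u) *m hess f u) (v - u)
              + H / 3 * enorm (v - u) ^+ 3)
    (grad_bound : forall u v : 'rV[R]_d,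
       enorm (grad f v - grad f u - (v - u) *m hess f u)
         <= H * enorm (v - u) ^+ 2)
    (xstar_min : forall y : 'rV[R]_d, f xstar <= f y)
    (D_finite : has_ubound (sublevel_dists f x0 xstar))
    (x_cacun : cacun f H x0 x) :
  let D := sup (sublevel_dists f x0 xstar) in
  forall k : nat, (1 <= k)%N ->
    f (x k) - f xstar <= 3 * H * D ^+ 3 / (1 + k%:R / 3) ^+ 2.
Proof.
move=> D k k_ge1.
have [f_diff _] := f_diff2; have [x_0 x_step] := x_cacun.
have dist v : f v <= f x0 -> enorm (v - xstar) <= D.
  by move=> vx0; apply: ub_le_sup => //; exists v.
have D_ge0 : 0 <= D by apply: le_trans (dist x0 (lexx _)); exact: enorm_ge0.
have gap0 n : 0 <= f (x n) - f xstar by rewrite subr_ge0.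
have x_sublevel n : f (x n) <= f x0.
  elim: n => [|n IHn]; first by rewrite x_0.
  apply: le_trans IHn.
  exact: cacun_step_le f_convex f_diff H_gt0 (f_upper _) (x_step n).
have [D_eq0|D_neq0] := eqVneq D 0.
  have := gap_le_enorm f_convex f_diff (dist _ (x_sublevel k)).
  by rewrite D_eq0 expr0n/= !mulr0 mul0r.
have D_gt0 : 0 < D by rewrite lt_neqAle eq_sym D_neq0.
have decrease n := cacun_step_decrease f_convex f_diff H_gt0
  (f_upper (x n)) (grad_bound _ _) xstar_min
  (fun v vn => dist v (le_trans vn (x_sublevel n))) D_gt0 (x_step n).
have K_gt0 : 0 < H * D ^+ 3 by rewrite mulr_gt0 ?exprn_gt0.
pose u n := (f (x n) - f xstar) / (H * D ^+ 3).
have u0 n : 0 <= u n by rewrite divr_ge0 ?gap0 ?(ltW K_gt0).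
have := decrease_rate u0 decrease k_ge1.
rewrite /u ler_pdivrMr// => rate; apply: (le_trans rate).
rewrite le_eqVlt; apply/orP; left; apply/eqP; field.
have := ler0n R k; lra.
Qed.
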